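(* Let $u_n(x)=x^n$, $n\geq 2$, and consider $\Sigma_{u_n}$ the upwards oriented surface in $\mathbb{R}^3$ obtained by rotating the graph of $u_n(x)$ around the $z$-axis. Then, $\Sigma_{u_n}$ is a $\mathfrak{K}_n$-surface for the prescribed function $$ \mathfrak{K}_n(y)=(n-1)\,y^{\frac{2n}{n-1}}(1-y^2)^{\frac{n-2}{n-1}}. $$
   Context: An immersed, oriented surface $\Sigma$ in $\mathbb{R}^3$ with Gauss map $\eta$ is a $\mathfrak{K}$-surface, for a prescribed function $\mathfrak{K}$, if its Gauss curvature satisfies $K_\Sigma(p)=\mathfrak{K}(\langle\eta_p,e_3\rangle)$ for every $p\in\Sigma$, where $e_3=(0,0,1)$; the quantity $\langle\eta_p,e_3\rangle$ is called the angle function. The graph of $u_n$ is the curve $(x,0,u_n(x))$, $x\geq 0$. With the upwards orientation, the angle function of $\Sigma_{u_n}$ is $1/\sqrt{1+u_n'(x)^2}=1/\sqrt{1+n^2x^{2(n-1)}}$. In this statement $\mathfrak{K}_n$ is not required to be $C^1$ at $y=1$, the value of the angle function at the intersection with the axis of rotation.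
   Formalization: The printed prescribed function lacks the constant factor n^{2/(n-1)}; the theorem proved uses n^{2/(n-1)}(n-1)y^{2n/(n-1)}(1-y^2)^{(n-2)/(n-1)} (for n=2 the vertex curvature is 4, not the printed 1). *)

(* Defs.v *)
From mathcomp Require Import all_boot all_order all_algebra.
From mathcomp Require Import all_classical all_reals all_analysis.
Import Order.TTheory GRing.Theory Num.Theory.
Import numFieldNormedType.Exports.

Set Implicit Arguments.
Unset Strict Implicit.
Unset Printing Implicit Defensive.

Local Open Scope classical_set_scope.
Local Open Scope ring_scope.

Definition dotp (R : realType) (v w : 'rV[R]_3) : R :=
  \sum_(i < 3) v 0 i * w 0 i.

Definition row3 (R : realType) (a b c : R) : 'rV[R]_3 :=
  \row_(j < 3) [:: a; b; c]`_j.

Definition e3 (R : realType) : 'rV[R]_3 := row3 0 0 1.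

Definition C1_on (R : realType) (V W : normedModType R)
    (U : set V) (f : V -> W) : Prop :=
  forall q, U q -> differentiable f q /\ forall v, {for q, continuous ('D_v f)}.

Definition C2_on (R : realType) (V W : normedModType R)
    (U : set V) (f : V -> W) : Prop :=
  C1_on U f /\ forall v, C1_on U ('D_v f).

(* Local parametrizations of a subset S of R^3.  The last clause says that X
   is an open map from U to S with its induced topology; as X is continuous
   and injective on U, this makes X a homeomorphism from U onto a relatively
   open subset of S. *)
Definition parametrization (R : realType) (S : set 'rV[R]_3)
    (U : set 'rV[R]_2) (X : 'rV[R]_2 -> 'rV[R]_3) : Prop :=
  [/\ open U,
      C2_on U X,
      forall q, U q -> injective ('d X q),
      forall q q', U q -> U q' -> X q = X q' -> q = q' &
      forall W : set 'rV[R]_2, open W -> W `<=` U ->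
        exists2 V : set 'rV[R]_3, open V & X @` W = S `&` V].

(* Class C^2 is what the Gauss curvature requires; for odd n the surface
   obtained by rotating the graph of x^n is not smooth at the axis. *)
Definition regular_surface (R : realType) (S : set 'rV[R]_3) : Prop :=
  forall p, S p -> exists U X q, [/\ parametrization S U X, U q & X q = p].

(* Only the values of eta on S are meaningful; the tangent plane of S at X q
   is the image of the differential of X at q. *)
Definition gauss_map (R : realType) (S : set 'rV[R]_3)
    (eta : 'rV[R]_3 -> 'rV[R]_3) : Prop :=
  [/\ {within S, continuous eta},
      forall p, S p -> dotp (eta p) (eta p) = 1 &
      forall U X q v, parametrization S U X -> U q ->
        dotp (eta (X q)) ('d X q v) = 0].

(* K = det (d eta_p) on the tangent plane at p = X q: by the chain rule
   d eta_p o dX_q = d (eta o X)_q, so A is the matrix of d eta_p read through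
   the isomorphism dX_q.  As dX_q is injective, A and hence K are unique. *)
Definition gauss_curvature (R : realType) (eta : 'rV[R]_3 -> 'rV[R]_3)
    (X : 'rV[R]_2 -> 'rV[R]_3) (q : 'rV[R]_2) (K : R) : Prop :=
  differentiable (eta \o X) q /\
  exists2 A : 'M[R]_2,
    forall v, 'd (eta \o X) q v = 'd X q (v *m A) & K = \det A.

Definition angle (R : realType) (eta : 'rV[R]_3 -> 'rV[R]_3) (p : 'rV[R]_3) : R :=
  dotp (eta p) (e3 R).

Definition K_surface (R : realType) (KK : R -> R) (S : set 'rV[R]_3)
    (eta : 'rV[R]_3 -> 'rV[R]_3) : Prop :=
  [/\ regular_surface S,
      gauss_map S eta &
      forall U X q, parametrization S U X -> U q ->
        gauss_curvature eta X q (KK (angle eta (X q)))].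

Definition upward_gauss_map (R : realType) (S : set 'rV[R]_3)
    (eta : 'rV[R]_3 -> 'rV[R]_3) : Prop :=
  gauss_map S eta /\ forall p, S p -> 0 < angle eta p.

Definition rotz (R : realType) (t : R) (p : 'rV[R]_3) : 'rV[R]_3 :=
  row3 (cos t * p 0 0 - sin t * p 0 1) (sin t * p 0 0 + cos t * p 0 1)
       (p 0 ord_max).

Definition revolution (R : realType) (u : R -> R) : set 'rV[R]_3 :=
  [set p | exists t x, 0 <= x /\ p = rotz t (row3 x 0 (u x))].

(* powR satisfies 0 `^ a = 0 for a != 0 and 0 `^ 0 = 1, so that this is the
   continuous function on ]0, 1] also at y = 1, including for n = 2.

   Rotating the graph of x^n gives K = n^2 (n-1) x^(2n-4) y^4, y being the
   angle function, and n^2 x^(2n-2) = (1 - y^2) / y^2.  Eliminating x gives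
   K = n^(2/(n-1)) * K_profile n y; the constant n^(2/(n-1)) cannot be
   dropped: for n = 2 (the paraboloid z = x^2 + y^2) the curvature at the
   vertex, where y = 1, is 4, whereas K_profile 2 1 = 1.  K_profile alone is
   the prescribed function of the graph of x^n / n. *)
Definition K_profile (R : realType) (n : nat) (y : R) : R :=
  (n%:R - 1) * y `^ (2 * n%:R / (n%:R - 1)) *
  (1 - y ^+ 2) `^ ((n%:R - 2) / (n%:R - 1)).

(* Main.v *)
Require Import Defs.
From HB Require Import structures.
From mathcomp Require Import all_boot all_order all_algebra.
From mathcomp Require Import all_classical all_reals all_analysis.
From mathcomp Require Import ring.
Import Order.TTheory GRing.Theory Num.Theory.
Import numFieldNormedType.Exports.
Local Open Scope classical_set_scope.
Local Open Scope ring_scope.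

(* With r = |v| and n = k + 2, the surface is the graph of r^n over the plane.
   This function is C^2 also at the origin: its gradient is n r^k v, and each
   map r^k v_i is differentiable everywhere.  With W = sqrt (1 + n^2 r^(2n-2)),
   the upward unit normal is (- n r^k v, 1) / W, and its differential in graph
   coordinates is B = a I + b v^T v, with a = - n r^k / W and
   a + b r^2 = - n (n-1) r^k / W^3, so K = det B = n^2 (n-1) r^(2k) / W^4;
   substituting y = 1 / W gives the profile.  Any other parametrization X
   factors locally through the graph as X = G o h with dh invertible, which
   conjugates B by dh and preserves the determinant. *)

(** * Rules of differential calculus with explicit differentials *)

Section Differentials.
Context {R : realType} {V W : normedModType R}.

(** The differential is unique: any continuous linear map that approximates the increments to first
    order must be it. This form allows a proof from an explicit estimate where no product or chain
    rule applies. *)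
Lemma is_diff_of_linear (f : V -> W) (df : {linear V -> W}) (x : V) :
  continuous df ->
  (forall e, 0 < e ->
     \forall h \near 0, `|f (h + x) - f x - df h| <= e * `|h|) ->
  is_diff x f df.
Proof.
move=> cdf H.
have E : f \o shift x = cst (f x) + df +o_ 0 id.
  apply/eqaddoP => e e0; have := H e e0; apply: filterS => h /=.
  by rewrite !fctE /= opprD addrA.
have dfE : 'd f x = df :> (V -> W) by apply: diff_unique.
apply: DiffDef => //; apply/diff_locallyP; rewrite dfE; split => //.
Qed.

(** The differential depends only on the germ at [x]. This transfers it through identities valid
    only near a point, such as X = G o h on the domain of a parametrization. *)
Lemma is_diff_near_eq {f g df : V -> W} {x : V} :
  is_diff x f df -> (\forall y \near x, f y = g y) -> is_diff x g df.
Proof.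
move=> fx fg; have [dfx dfE] := fx; rewrite -dfE.
apply: is_diff_of_linear; first exact: diff_continuous.
have /eqaddoP E := diff_locally dfx.
move=> e e0; have := E e e0.
have gx := nbhs_singleton fg.
move: fg; rewrite (near_shift 0) subr0 => fg; move: fg.
apply: filterS2 => h /= fgh; rewrite !fctE /= fgh -gx.
by rewrite opprD addrA.
Qed.

Lemma is_diff_const (a : W) (x : V) : is_diff x (fun=> a) (fun=> 0).
Proof. exact: is_diff_cst. Qed.

Lemma is_diff_mul {f g df dg : V -> R} {x : V} :
  is_diff x f df -> is_diff x g dg ->
  is_diff x (fun v => f v * g v) (fun w => f x * dg w + g x * df w).
Proof. by move=> fx gx; exact: (is_diffM fx gx). Qed.

Lemma is_diff_add {f g df dg : V -> W} {x : V} :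
  is_diff x f df -> is_diff x g dg ->
  is_diff x (fun v => f v + g v) (fun w => df w + dg w).
Proof. by move=> fx gx; exact: (is_diffD fx gx). Qed.

Lemma is_diff_exp {f df : V -> R} {x : V} (n : nat) :
  is_diff x f df ->
  is_diff x (fun v => f v ^+ n) (fun w => n%:R * f x ^+ n.-1 * df w).
Proof.
move=> fx; case: n => [|n].
  apply: (is_diff_eq (is_diff_cst (1 : R) x)).
  by apply/funext => w /=; rewrite !mul0r.
have -> : (fun v => f v ^+ n.+1) = f ^+ n.+1.
  by apply/funext => v; rewrite exprfctE.
exact: (is_diffX n fx).
Qed.

Lemma is_diff_comp1 {f df : V -> R} {g : R -> R} {dg : R} {x : V} :
  is_diff x f df -> is_derive (f x) 1 g dg ->
  is_diff x (fun v => g (f v)) (fun w => dg * df w).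
Proof.
move=> fx [gx gE].
have gx' : is_diff (f x) g (fun h => dg * h).
  have dgx : differentiable g (f x) by apply/derivable1_diffP.
  apply: DiffDef => //; rewrite diff1E //; apply/funext => h /=.
  by rewrite derive1E gE /= /GRing.scale /= mulrC.
exact: (is_diff_comp fx gx').
Qed.

Lemma is_diff_inv {f df : V -> R} {x : V} :
  is_diff x f df -> f x != 0 ->
  is_diff x (fun v => (f v)^-1) (fun w => - (f x) ^- 2 * df w).
Proof.
move=> [fx fE] fx0; apply: DiffDef; first exact: differentiableV.
by rewrite diffV // fE.
Qed.

Lemma is_diff_scalel_fun {f df : V -> R} (a : W) {x : V} :
  is_diff x f df -> is_diff x (fun v => f v *: a) (fun w => df w *: a).
Proof.
move=> [fx fE]; apply: DiffDef; first exact: differentiableZl.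
by rewrite diffZl // fE.
Qed.

Lemma is_diff_continuous {f df : V -> W} {x : V} :
  is_diff x f df -> {for x, continuous f}.
Proof. by move=> [fx _]; exact: differentiable_continuous. Qed.

Lemma is_diff_derive {f df : V -> W} {x v : V} :
  is_diff x f df -> 'D_v f x = df v.
Proof. by move=> [fx fE]; rewrite deriveE // fE. Qed.

End Differentials.

(** * Maps into matrices and R^3, coordinate by coordinate *)

Section Coordinates.
Context {R : realType}.

Lemma is_diff_coord {m n : nat} (i : 'I_m) (j : 'I_n) (M : 'M[R]_(m, n)) :
  is_diff M (fun N : 'M[R]_(m, n) => N i j : R) (fun N => N i j).
Proof.
have lin : linear (fun N : 'M[R]_(m, n) => N i j : R).
  by move=> a u w; rewrite !mxE.
pose fM := GRing.isLinear.Build _ _ _ _ _ lin.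
pose f : {linear 'M[R]_(m, n) -> R} :=
  HB.pack (fun N : 'M[R]_(m, n) => N i j) fM.
have cf : continuous f by exact: coord_continuous.
have -> : (fun N : 'M[R]_(m, n) => N i j : R) = f by [].
by apply: DiffDef; [exact: linear_differentiable|exact: diff_lin].
Qed.

(** Expansion in a fixed basis, which reduces differentiability and continuity of maps into R^3 to
    those of scalar functions. *)
Lemma row3E (a b c : R) :
  row3 a b c = a *: row3 1 0 0 + b *: row3 0 1 0 + c *: row3 0 0 1.
Proof.
apply/rowP => i; rewrite !mxE.
by case: i => [[|[|[|]]]] //= _; rewrite !(mulr0, mulr1, addr0, add0r).
Qed.

Lemma is_diff_row3 {V : normedModType R} {a b c da db dc : V -> R} {x : V} :
  is_diff x a da -> is_diff x b db -> is_diff x c dc ->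
  is_diff x (fun v => row3 (a v) (b v) (c v))
    (fun w => row3 (da w) (db w) (dc w)).
Proof.
move=> ax bx cx; under eq_fun do rewrite row3E.
under [X in is_diff _ _ X]eq_fun do rewrite row3E.
by do ?apply: is_diff_add; apply: is_diff_scalel_fun.
Qed.

End Coordinates.

(** * The Euclidean radius in the plane *)

Section Radius.
Context {R : realType}.
Implicit Types v w : 'rV[R]_2.

Definition dot2 v w : R := v 0 0 * w 0 0 + v 0 1 * w 0 1.

Definition radius v : R := Num.sqrt (dot2 v v).

Lemma dot2_ge0 v : 0 <= dot2 v v.
Proof. by rewrite addr_ge0 // -expr2 sqr_ge0. Qed.

Lemma radius_sqr v : radius v ^+ 2 = dot2 v v.
Proof. by rewrite sqr_sqrtr // dot2_ge0. Qed.

Lemma radius_ge0 v : 0 <= radius v.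
Proof. exact: sqrtr_ge0. Qed.

Lemma rowP2 v w : v 0 0 = w 0 0 -> v 0 1 = w 0 1 -> v = w.
Proof.
move=> h0 h1; apply/rowP => i.
case: i => [[|[|//]]] h.
- by rewrite (_ : Ordinal h = 0); [exact: h0|exact/val_inj].
- by rewrite (_ : Ordinal h = 1); [exact: h1|exact/val_inj].
Qed.

Lemma radius_eq0 v : (radius v == 0) = (v == 0).
Proof.
rewrite sqrtr_eq0 le_eqVlt ltNge dot2_ge0 orbF.
apply/eqP/eqP => [|->]; last by rewrite /dot2 !mxE; ring.
move=> /eqP; rewrite /dot2 -!expr2 paddr_eq0 ?sqr_ge0 // !sqrf_eq0.
by move=> /andP[/eqP h0 /eqP h1]; apply: rowP2; rewrite mxE.
Qed.

Lemma ler_coord_radius v (i : 'I_2) : `|v 0 i| <= radius v.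
Proof.
rewrite -(ler_pXn2r (ltn0Sn 1)) ?nnegrE ?radius_ge0 //.
rewrite radius_sqr real_normK ?num_real // /dot2 -!expr2.
case: i => [[|[|//]]] h.
- by rewrite (_ : Ordinal h = 0); [rewrite lerDl sqr_ge0|exact/val_inj].
- by rewrite (_ : Ordinal h = 1); [rewrite lerDr sqr_ge0|exact/val_inj].
Qed.

Lemma is_diff_dot2 v : is_diff v (fun v => dot2 v v) (fun w => 2 * dot2 v w).
Proof.
apply: is_diff_eq.
  by apply: is_diff_add; apply: is_diff_mul; exact: is_diff_coord.
by apply/funext => w; rewrite /dot2; ring.
Qed.

Lemma is_diff_dot2l w v : is_diff v (dot2^~ w) (dot2^~ w).
Proof.
have D (i : 'I_2) :=
  is_diff_mul (is_diff_coord 0 i v) (is_diff_const (w 0 i) v).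
apply: (is_diff_eq (is_diff_add (D 0) (D 1))).
by apply/funext => u /=; rewrite /dot2; ring.
Qed.

Lemma dot2_continuous : continuous (fun v => dot2 v v).
Proof. by move=> v; exact: is_diff_continuous (is_diff_dot2 v). Qed.

Lemma dot2l_continuous w : continuous (dot2^~ w).
Proof. by move=> v; exact: is_diff_continuous (is_diff_dot2l w v). Qed.

Lemma radius_continuous : continuous radius.
Proof.
move=> v; apply: (continuous_comp (@dot2_continuous v)).
exact: sqrt_continuous.
Qed.

Lemma is_diff_radius v : v != 0 ->
  is_diff v radius (fun w => dot2 v w / radius v).
Proof.
move=> v0; have r0 : 0 < radius v.
  by rewrite lt_neqAle eq_sym radius_eq0 v0 radius_ge0.
have s0 : 0 < dot2 v v by rewrite -radius_sqr exprn_gt0.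
apply: is_diff_eq.
  exact: (is_diff_comp1 (is_diff_dot2 v) (is_derive1_sqrt s0)).
apply/funext => w; rewrite -/(radius v); field.
by rewrite gt_eqF.
Qed.

(* Only continuity of g is needed: g(v) v_i - g(0) v_i = o(|v|). *)
Lemma is_diff_mul_coord0 (g : 'rV[R]_2 -> R) (i : 'I_2) :
  {for 0, continuous g} ->
  is_diff (0 : 'rV[R]_2) (fun v => g v * v 0 i) (fun w => g 0 * w 0 i).
Proof.
move=> cg; have lin : linear (fun w : 'rV[R]_2 => g 0 * w 0 i : R).
  by move=> a u w; rewrite !mxE /GRing.scale /=; ring.
pose fM := GRing.isLinear.Build _ _ _ _ _ lin.
pose f : {linear 'rV[R]_2 -> R} := HB.pack (fun w : 'rV[R]_2 => g 0 * w 0 i) fM.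
have cf : continuous f.
  move=> v; apply: is_diff_continuous.
  exact: (is_diff_mul (is_diff_const (g 0) v) (is_diff_coord 0 i v)).
apply: (@is_diff_of_linear _ _ _ _ f) => // e e0.
move/cvgrPdist_le : cg => /(_ e e0); apply: filterS => h /= gh.
rewrite addr0 mxE mulr0 subr0 -mulrBl normrM distrC ler_pM //.
(* The norm on row vectors is the maximum norm, so it dominates each coordinate. *)
rewrite [leRHS]/Num.Def.normr /= mx_normrE.
exact: (le_bigmax _ (fun ij => `|h ij.1 ij.2|) (0, i)).
Qed.

End Radius.

(** * First and second derivatives of powers of the radius, including at the origin *)

Section RadialDerivatives.
Context {R : realType}.
Implicit Types v w u : 'rV[R]_2.

Lemma dot20l w : dot2 0 w = 0 :> R.
Proof. by rewrite /dot2 !mxE !mul0r addr0. Qed.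

Lemma radius_exp_continuous (k : nat) :
  continuous (fun v : 'rV[R]_2 => radius v ^+ k).
Proof.
move=> v; exact: (continuous_comp (@radius_continuous R v)
                    (@exprn_continuous _ k (radius v))).
Qed.

(* At the origin x / 0 = 0 makes the last term vanish, as it should. *)
Lemma is_diff_radius_exp_coord (k : nat) (i : 'I_2) v :
  is_diff v (fun v => radius v ^+ k * v 0 i)
    (fun w => radius v ^+ k * w 0 i +
       k%:R * radius v ^+ k.-1 * (dot2 v w / radius v) * v 0 i).
Proof.
have [->|v0] := eqVneq v 0.
  apply: is_diff_eq.
    by apply: is_diff_mul_coord0; exact: radius_exp_continuous.
  by apply/funext => w; rewrite !mxE mulr0 addr0.
apply: (is_diff_eq (is_diff_mul (is_diff_exp k (is_diff_radius _ v0))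
                      (is_diff_coord 0 i v))).
by apply/funext => w /=; ring.
Qed.

(** Since r^(k+2) = (r^k v_0) v_0 + (r^k v_1) v_1, the product rule applies to factors that are
    differentiable everywhere; the origin only needs separate algebra. *)
Lemma is_diff_radius_expS2 (k : nat) v :
  is_diff v (fun v => radius v ^+ k.+2)
    (fun w => k.+2%:R * radius v ^+ k * dot2 v w).
Proof.
have D (i : 'I_2) :=
  is_diff_mul (is_diff_radius_exp_coord k i v) (is_diff_coord 0 i v).
have -> : (fun v => radius v ^+ k.+2) =
    (fun v => radius v ^+ k * v 0 0 * v 0 0 + radius v ^+ k * v 0 1 * v 0 1).
  by apply/funext => x; rewrite -addn2 exprD radius_sqr /dot2; ring.
apply: (is_diff_eq (is_diff_add (D 0) (D 1))); apply/funext => w /=.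
have [->|v0] := eqVneq v 0; first by rewrite /dot2 !mxE; ring.
have r0 : radius v != 0 by rewrite radius_eq0.
transitivity (2 * radius v ^+ k * dot2 v w +
    k%:R * radius v ^+ k.-1 / radius v * dot2 v v * dot2 v w).
  by rewrite /dot2; ring.
rewrite -radius_sqr; case: k D => [|k] _; first by rewrite !mul0r; ring.
have -> : k.+3%:R = k.+1%:R + 2 :> R by rewrite -natrD addn2.
by rewrite /= exprS; field.
Qed.

(** With m = k - 1 this is the delicate term in the second derivative of r^(k+2). At the origin the
    quotient is merely bounded, and the factor [dot2 v w], which tends to 0, gives continuity even
    for m = 0. *)
Lemma continuous_quadratic_radius (m : nat) (u w : 'rV[R]_2) :
  continuous (fun v => radius v ^+ m * (dot2 v u / radius v) * dot2 v w).
Proof.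
move=> /= v; have cr : radius x @[x --> v] --> radius v.
  exact: radius_continuous.
have crm : radius x ^+ m @[x --> v] --> radius v ^+ m.
  exact: radius_exp_continuous.
have [v0|v0] := eqVneq v 0; last first.
  have r0 : radius v != 0 by rewrite radius_eq0.
  exact: (cvgM (cvgM crm (cvgM (@dot2l_continuous R u v) (cvgV r0 cr)))
             (@dot2l_continuous R w v)).
pose c : R := `|u 0 0| + `|u 0 1|.
(* Each coordinate of x is at most its radius in absolute value; at x = 0 the quotient is 0 by x / 0
   = 0. *)
have B x : `|dot2 x u / radius x| <= c.
  have [->|x0] := eqVneq x 0.
    by rewrite dot20l mul0r normr0 addr_ge0.
  have r0 : 0 < radius x by rewrite lt_neqAle eq_sym radius_eq0 x0 radius_ge0.
  rewrite normrM normfV (ger0_norm (radius_ge0 x)) ler_pdivrMr //.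
  rewrite (le_trans (ler_normD _ _)) // !normrM mulrDl.
  by rewrite lerD // mulrC ler_wpM2l // ler_coord_radius.
have L : radius x ^+ m * c * `|dot2 x w| @[x --> v] --> (0 : R).
  have E : radius v ^+ m * c * `|dot2 v w| = 0.
    by rewrite v0 dot20l normr0 mulr0.
  rewrite -E; exact: (cvgM (cvgMr_tmp (b := c) crm)
    (cvg_norm (@dot2l_continuous R w v))).
pose f (x : 'rV[R]_2) := radius x ^+ m * (dot2 x u / radius x) * dot2 x w.
have L0 : `|f x| @[x --> v] --> (0 : R).
  apply: (@squeeze_cvgr _ _ _ _ (cst 0) _ _ _ _ _ L); last exact: cvg_cst.
  apply: nearW => x; rewrite normr_ge0 !normrM /= ler_wpM2r // ler_pM //.
  - by rewrite ger0_norm // exprn_ge0 // radius_ge0.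
  - by rewrite -normrM.
have f0 : f v = 0 by rewrite /f v0 !dot20l mulr0.
by move/norm_cvg0 : L0; rewrite -f0.
Qed.

Lemma continuous_row3 (T : topologicalType) (a b c : T -> R) (x : T) :
  {for x, continuous a} -> {for x, continuous b} -> {for x, continuous c} ->
  {for x, continuous (fun t => row3 (a t) (b t) (c t))}.
Proof.
move=> ax bx cx; rewrite /prop_for /continuous_at row3E.
under eq_fun do rewrite row3E.
by do ?apply: cvgD; apply: cvgZr_tmp.
Qed.

End RadialDerivatives.

(** * The surface of revolution as a graph over the plane *)

Section GraphGeometry.
Context {R : realType}.
Implicit Types (v w : 'rV[R]_2) (p q : 'rV[R]_3).

Lemma row3_0 (a b c : R) : row3 a b c 0 0 = a.
Proof. by rewrite mxE. Qed.

Lemma row3_1 (a b c : R) : row3 a b c 0 1 = b.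
Proof. by rewrite mxE. Qed.

Lemma row3_2 (a b c : R) : row3 a b c 0 ord_max = c.
Proof. by rewrite mxE. Qed.

Definition row3_coords := (row3_0, row3_1, row3_2).

Lemma row3_eta p : row3 (p 0 0) (p 0 1) (p 0 ord_max) = p.
Proof.
apply/rowP => i; rewrite mxE.
by case: i => [[|[|[|//]]]] h /=; congr (p 0 _); exact/val_inj.
Qed.

Lemma dotp_row3 p (a b c : R) :
  dotp p (row3 a b c) = p 0 0 * a + p 0 1 * b + p 0 ord_max * c.
Proof.
rewrite -[p in LHS]row3_eta /dotp !big_ord_recr big_ord0 /= add0r.
by rewrite !mxE.
Qed.

Lemma angleE (eta : 'rV[R]_3 -> 'rV[R]_3) p : angle eta p = eta p 0 ord_max.
Proof. by rewrite /angle dotp_row3 !mulr0 mulr1 !add0r. Qed.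

(** Projection to the horizontal plane, the inverse of the graph map on the surface; as a
    combination of constant vectors it is visibly linear. *)
Definition hproj p : 'rV[R]_2 :=
  p 0 0 *: delta_mx 0 0 + p 0 1 *: delta_mx 0 1.

Lemma hproj0 p : hproj p 0 0 = p 0 0.
Proof. by rewrite !mxE /= mulr1 mulr0 addr0. Qed.

Lemma hproj1 p : hproj p 0 1 = p 0 1.
Proof. by rewrite !mxE /= mulr1 mulr0 add0r. Qed.

Lemma is_diff_hproj p : is_diff p hproj hproj.
Proof.
exact: (is_diff_add (is_diff_scalel_fun _ (is_diff_coord 0 0 p))
          (is_diff_scalel_fun _ (is_diff_coord 0 1 p))).
Qed.

Lemma hproj_row3 v (c : R) : hproj (row3 (v 0 0) (v 0 1) c) = v.
Proof. by apply: rowP2; rewrite ?hproj0 ?hproj1 !row3_coords. Qed.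

Variable k : nat.
Let n : R := k.+2%:R.

Definition power_graph v : 'rV[R]_3 :=
  row3 (v 0 0) (v 0 1) (radius v ^+ k.+2).

Definition power_graph_diff v w : 'rV[R]_3 :=
  row3 (w 0 0) (w 0 1) (n * radius v ^+ k * dot2 v w).

Lemma hproj_power_graph v : hproj (power_graph v) = v.
Proof. exact: hproj_row3. Qed.

Lemma hproj_power_graph_diff v w : hproj (power_graph_diff v w) = w.
Proof. exact: hproj_row3. Qed.

Lemma is_diff_power_graph v : is_diff v power_graph (power_graph_diff v).
Proof.
exact: (is_diff_row3 (is_diff_coord 0 0 v) (is_diff_coord 0 1 v)
          (is_diff_radius_expS2 k v)).
Qed.

Lemma derive_power_graph w : 'D_w power_graph = power_graph_diff ^~ w.
Proof. by apply/funext => v; exact: is_diff_derive (is_diff_power_graph v). Qed.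

(** Expanding [dot2 v w] writes the third coordinate as a combination of the maps r^k v_i with
    constant coefficients n w_i, and these are differentiable also at the origin. *)
Lemma is_diff_power_graph_diff v w :
  is_diff v (power_graph_diff ^~ w)
    (fun u => row3 0 0 (n * (radius v ^+ k * dot2 u w +
       k%:R * (radius v ^+ k.-1 * (dot2 v u / radius v) * dot2 v w)))).
Proof.
have D (i : 'I_2) := is_diff_mul (is_diff_radius_exp_coord k i v)
                       (is_diff_const (n * w 0 i) v).
have E : (power_graph_diff ^~ w) = fun v => row3 (w 0 0) (w 0 1)
   (radius v ^+ k * v 0 0 * (n * w 0 0) + radius v ^+ k * v 0 1 * (n * w 0 1)).
  by apply/funext => x; congr row3; rewrite /dot2; ring.
rewrite E; apply: (is_diff_eq (is_diff_row3 (is_diff_const (w 0 0) v)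
  (is_diff_const (w 0 1) v) (is_diff_add (D 0) (D 1)))).
apply/funext => u /=; congr row3.
rewrite /dot2 /cst /=. ring.
Qed.

Lemma C2_power_graph : C2_on setT power_graph.
Proof.
split=> [v _|w v _]; last rewrite derive_power_graph.
  split=> [|w]; first by have [] := is_diff_power_graph v.
  rewrite derive_power_graph.
  exact: is_diff_continuous (is_diff_power_graph_diff v w).
split=> [|u]; first by have [] := is_diff_power_graph_diff v w.
rewrite (_ : 'D_u _ = fun v => row3 0 0 (n * (radius v ^+ k * dot2 u w +
       k%:R * (radius v ^+ k.-1 * (dot2 v u / radius v) * dot2 v w))));
  last first.
  by apply/funext => x; exact: is_diff_derive (is_diff_power_graph_diff x w).
apply: continuous_row3; [exact: cst_continuous|exact: cst_continuous|].
exact: (cvgMl_tmp (a := n) (cvgD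
  (cvgMr_tmp (b := dot2 u w) (@radius_exp_continuous R k v))
  (cvgMl_tmp (a := k%:R) (@continuous_quadratic_radius R k.-1 u w v)))).
Qed.

Lemma parametrization_power_graph :
  parametrization (range power_graph) setT power_graph.
Proof.
split.
- exact: openT.
- exact: C2_power_graph.
- move=> v _ w w'; have [_ ->] := is_diff_power_graph v => /(congr1 hproj).
  by rewrite !hproj_power_graph_diff.
- by move=> v w _ _ /(congr1 hproj); rewrite !hproj_power_graph.
(* The part of the graph over W is cut out by the vertical cylinder over W, which is open. *)
- move=> W oW _; exists (hproj @^-1` W).
    apply: open_comp => // p _.
    exact: is_diff_continuous (is_diff_hproj p).
  apply/seteqP; split=> [_ [v Wv <-]|_ [[v _ <-]]] /=.
    by split; [exists v|rewrite /preimage /= hproj_power_graph].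
  by rewrite /preimage /= hproj_power_graph => Wv; exists v.
Qed.

(** The angle is arccos (a / x), where x is the radius, negated when b < 0; at the origin any angle
    works. *)
Lemma polar_coordinates (a b : R) :
  exists t, a = Num.sqrt (a ^+ 2 + b ^+ 2) * cos t /\
            b = Num.sqrt (a ^+ 2 + b ^+ 2) * sin t.
Proof.
pose x : R := Num.sqrt (a ^+ 2 + b ^+ 2); rewrite -/x.
have x2 : x ^+ 2 = a ^+ 2 + b ^+ 2 by rewrite sqr_sqrtr // addr_ge0 ?sqr_ge0.
have [x0|x0] := eqVneq x 0.
  have /eqP : a ^+ 2 + b ^+ 2 = 0 by rewrite -x2 x0 expr0n.
  rewrite paddr_eq0 ?sqr_ge0 // !sqrf_eq0 => /andP[/eqP-> /eqP->].
  by exists 0; rewrite x0 !mul0r.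
have xp : 0 < x by rewrite lt_neqAle eq_sym x0 sqrtr_ge0.
have ax : -1 <= a / x <= 1.
  rewrite -ler_norml normrM normfV (gtr0_norm xp) ler_pdivrMr // mul1r.
  by rewrite -sqrtr_sqr ler_wsqrtr // lerDl sqr_ge0.
have sE : sin (acos (a / x)) = `|b| / x.
  rewrite sin_acos //; transitivity (Num.sqrt ((b / x) ^+ 2)); last first.
    by rewrite sqrtr_sqr normrM normfV (gtr0_norm xp).
  congr Num.sqrt; rewrite !expr_div_n.
  have -> : b ^+ 2 = x ^+ 2 - a ^+ 2 by rewrite x2 addrC addKr.
  by field.
have cE : cos (acos (a / x)) = a / x by rewrite acosK // in_itv.
have [b0|b0] := leP 0 b.
  exists (acos (a / x)); rewrite cE sE ger0_norm // !(mulrC x) !divfK //.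
exists (- acos (a / x)); rewrite cosN sinN cE sE ltr0_norm //.
by rewrite -mulNr opprK !(mulrC x) !divfK.
Qed.

Lemma revolution_power : revolution (fun x => x ^+ k.+2) = range power_graph.
Proof.
apply/seteqP; split=> [p [t [x [x0 ->]]]|_ [v _ <-]].
  exists (\row_j (if j == 0 then cos t * x else sin t * x)) => //.
  rewrite /power_graph /rotz !row3_coords !mxE /= !mulr0 subr0 addr0.
  congr row3; congr (_ ^+ _); rewrite /radius /dot2 !mxE /=.
  (* As x >= 0, x is the square root of x^2 = (cos t x)^2 + (sin t x)^2. *)
  rewrite -[RHS](ger0_norm x0) -sqrtr_sqr; congr Num.sqrt.
  by rewrite -[RHS]mulr1 -(cos2Dsin2 t); ring.
have [t [v0 v1]] := polar_coordinates (v 0 0) (v 0 1).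
exists t, (radius v); split; first exact: radius_ge0.
rewrite /rotz !row3_coords !mulr0 subr0 addr0 /power_graph.
by congr row3; rewrite mulrC /radius /dot2 -!expr2 -?v0 -?v1.
Qed.

End GraphGeometry.

(** * The upward unit normal, its differential and the determinant *)

Lemma det_mx2 {R : comNzRingType} (M : 'M[R]_2) :
  \det M = M 0 0 * M 1 1 - M 0 1 * M 1 0.
Proof.
rewrite (expand_det_row _ 0) !big_ord_recr big_ord0 /= add0r.
rewrite /cofactor !det_mx11 !mxE /=.
have -> : widen_ord (leqnSn 1) ord_max = 0 :> 'I_2 by exact/val_inj.
have -> : ord_max = 1 :> 'I_2 by exact/val_inj.
have -> : lift (0 : 'I_2) 0 = 1 by exact/val_inj.
have -> : lift (1 : 'I_2) 0 = 0 by exact/val_inj.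
by rewrite expr0 expr1; ring.
Qed.

Section NormalOfPowerGraph.
Context {R : realType}.
Variable k : nat.
Implicit Types v w : 'rV[R]_2.
Let n : R := k.+2%:R.

(** The factor W. With r^(2n-2) written as a power of [dot2 v v], the radicand is a polynomial in
    [v], so W is differentiable at the origin too. *)
Definition slope_factor v : R := Num.sqrt (1 + n ^+ 2 * dot2 v v ^+ k.+1).

Definition normal v : 'rV[R]_3 :=
  row3 (- (n * (radius v ^+ k * v 0 0)) * (slope_factor v)^-1)
       (- (n * (radius v ^+ k * v 0 1)) * (slope_factor v)^-1)
       (slope_factor v)^-1.

Lemma slope_radicand_gt0 v : 0 < 1 + n ^+ 2 * dot2 v v ^+ k.+1.
Proof.
by rewrite ltr_pwDl // mulr_ge0 ?sqr_ge0 // exprn_ge0 // dot2_ge0.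
Qed.

Lemma slope_factor_gt0 v : 0 < slope_factor v.
Proof. by rewrite sqrtr_gt0 slope_radicand_gt0. Qed.

Lemma slope_factor_sqr v :
  slope_factor v ^+ 2 = 1 + n ^+ 2 * dot2 v v ^+ k.+1.
Proof. by rewrite sqr_sqrtr // ltW // slope_radicand_gt0. Qed.

Lemma radius_exp_sqr v : (radius v ^+ k) ^+ 2 = dot2 v v ^+ k.
Proof. by rewrite exprAC radius_sqr. Qed.

Lemma is_diff_slope_factorV v :
  is_diff v (fun v => (slope_factor v)^-1)
    (fun w => - (n ^+ 2 * k.+1%:R * dot2 v v ^+ k / slope_factor v ^+ 3
                 * dot2 v w)).
Proof.
have W0 := slope_factor_gt0 v.
have Wn : slope_factor v != 0 by rewrite gt_eqF.
have D1 := is_diff_add (is_diff_const (1 : R) v)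
  (is_diff_mul (is_diff_const (n ^+ 2) v) (is_diff_exp k.+1 (is_diff_dot2 v))).
have D2 := is_diff_comp1 D1 (is_derive1_sqrt (slope_radicand_gt0 v)).
apply: (is_diff_eq (is_diff_inv D2 Wn)); apply/funext => w /=.
rewrite -/(slope_factor v); field.
exact: Wn.
Qed.

(** The coefficient a: the eigenvalue of [shape v] orthogonally to [v], up to sign the principal
    curvature along the parallels. *)
Definition shape_scalar v : R := - (n * radius v ^+ k / slope_factor v).

(** The coefficient b: the first term comes from differentiating 1 / W, the second from
    differentiating r^k. At the origin the second is 0 by x / 0 = 0. *)
Definition shape_rank1 v : R :=
  n ^+ 3 * k.+1%:R * radius v ^+ k * dot2 v v ^+ k / slope_factor v ^+ 3
  - n * (k%:R * radius v ^+ k.-1 / radius v) / slope_factor v.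

(* The matrix, in the basis given by the graph parametrization, of the
   differential of the normal. *)
Definition shape v : 'M[R]_2 :=
  \matrix_(i, j) (shape_scalar v * (i == j)%:R + shape_rank1 v * v 0 i * v 0 j).

Lemma mul_shape v w (j : 'I_2) :
  (w *m shape v) 0 j =
  shape_scalar v * w 0 j + shape_rank1 v * dot2 v w * v 0 j.
Proof.
rewrite mxE !big_ord_recr big_ord0 /= add0r !mxE /dot2.
have -> : widen_ord (leqnSn 1) ord_max = 0 :> 'I_2 by exact/val_inj.
have -> : ord_max = 1 :> 'I_2 by exact/val_inj.
case: j => [[|[|//]]] h.
- by rewrite (_ : Ordinal h = 0) /=; [ring|exact/val_inj].
- by rewrite (_ : Ordinal h = 1) /=; [ring|exact/val_inj].
Qed.

(** The eigenvalue in the radial direction, up to sign the curvature u'' / W^3 of the meridian u =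
    r^n. *)
Lemma shape_radial v :
  shape_scalar v + shape_rank1 v * dot2 v v =
  - (n * k.+1%:R * radius v ^+ k / slope_factor v ^+ 3).
Proof.
have Wn : slope_factor v != 0 by rewrite gt_eqF // slope_factor_gt0.
(* This holds also at r = 0: for k = 0 the coefficient k vanishes, for k > 0 both sides carry a
   positive power of r. *)
have E : k%:R * radius v ^+ k.-1 / radius v * dot2 v v = k%:R * radius v ^+ k.
  rewrite -radius_sqr; have [->|r0] := eqVneq (radius v) 0.
    by case: k => [|[|m]]; rewrite ?mul0r // !exprS !mul0r !mulr0.
  by case: k => [|m]; rewrite ?mul0r //= [in RHS]exprS; field.
have WE : slope_factor v ^+ 2 - 1 = n ^+ 2 * (dot2 v v * dot2 v v ^+ k).
  by rewrite slope_factor_sqr -exprS addrC addKr.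
(* By [E] the first two terms sum to - n (k+1) r^k / W, which cancels the W^2 part of the last
   one. *)
transitivity (- (n * radius v ^+ k / slope_factor v) -
    n * (k%:R * radius v ^+ k.-1 / radius v * dot2 v v) / slope_factor v +
    n * k.+1%:R * radius v ^+ k * (slope_factor v ^+ 2 - 1) /
      slope_factor v ^+ 3).
  by rewrite WE /shape_scalar /shape_rank1; ring.
by rewrite E -[k.+1]addn1 natrD; field.
Qed.

(** The matrix a I + b v^T v has determinant a (a + b |v|^2), the product of its two eigenvalues. *)
Lemma det_shape v :
  \det (shape v) = n ^+ 2 * k.+1%:R * dot2 v v ^+ k / slope_factor v ^+ 4.
Proof.
have Wn : slope_factor v != 0 by rewrite gt_eqF // slope_factor_gt0.
transitivity (shape_scalar v * (shape_scalar v + shape_rank1 v * dot2 v v)).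
  by rewrite det_mx2 !mxE /= /dot2; ring.
rewrite shape_radial -radius_exp_sqr /shape_scalar; field.
exact: Wn.
Qed.

Lemma is_diff_normal v :
  is_diff v normal (fun w => power_graph_diff k v (w *m shape v)).
Proof.
have D (i : 'I_2) : is_diff v
    (fun v => - (n * (radius v ^+ k * v 0 i)) * (slope_factor v)^-1)
    (fun w => shape_scalar v * w 0 i + shape_rank1 v * dot2 v w * v 0 i).
  have D1 := is_diff_mul (is_diff_const (- n) v)
    (is_diff_radius_exp_coord k i v).
  have D2 := is_diff_mul D1 (is_diff_slope_factorV v).
  have -> : (fun v => - (n * (radius v ^+ k * v 0 i)) * (slope_factor v)^-1) =
    (fun v => - n * (radius v ^+ k * v 0 i) * (slope_factor v)^-1).
    by apply/funext => x; ring.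
  apply: (is_diff_eq D2); apply/funext => w /=.
  by rewrite /shape_scalar /shape_rank1; ring.
apply: (is_diff_eq (is_diff_row3 (D 0) (D 1) (is_diff_slope_factorV v))).
apply/funext => w; rewrite /power_graph_diff !mul_shape; congr row3.
(* The third coordinate confirms tangency: [dot2 v (w *m shape v)] equals the radial eigenvalue
   times [dot2 v w]. *)
transitivity (n * radius v ^+ k *
   ((shape_scalar v + shape_rank1 v * dot2 v v) * dot2 v w)).
  by rewrite shape_radial -radius_exp_sqr; ring.
by rewrite [dot2 v (_ *m _)]/dot2 !mul_shape /dot2; ring.
Qed.

Lemma dotp_normal v : dotp (normal v) (normal v) = 1.
Proof.
have Wn : slope_factor v != 0 by rewrite gt_eqF // slope_factor_gt0.
rewrite dotp_row3 !row3_coords.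
transitivity ((1 + n ^+ 2 * ((radius v ^+ k) ^+ 2 * dot2 v v))
              / slope_factor v ^+ 2).
  by rewrite /dot2; field.
by rewrite radius_exp_sqr -exprSr -slope_factor_sqr divff // expf_neq0.
Qed.

Lemma dotp_normal_tangent v w : dotp (normal v) (power_graph_diff k v w) = 0.
Proof. by rewrite dotp_row3 !row3_coords /dot2; ring. Qed.

(** Orthogonality to the two coordinate tangent vectors expresses the horizontal components through
    the vertical one; unit length then gives (W a_3)^2 = 1, and positivity fixes the sign. *)
Lemma normal_unique v (a : 'rV[R]_3) :
  dotp a a = 1 -> (forall w, dotp a (power_graph_diff k v w) = 0) ->
  0 < a 0 ord_max -> a = normal v.
Proof.
move=> a1 at0 a_gt0; have W0 := slope_factor_gt0 v.
have Wn : slope_factor v != 0 by rewrite gt_eqF.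
have E0 : a 0 0 = - (n * (radius v ^+ k * v 0 0)) * a 0 ord_max.
  have := at0 (delta_mx 0 0); rewrite dotp_row3 /dot2 !mxE /=.
  rewrite !mulr1 !mulr0 !addr0 => /eqP; rewrite addr_eq0 => /eqP ->.
  by rewrite /n; ring.
have E1 : a 0 1 = - (n * (radius v ^+ k * v 0 1)) * a 0 ord_max.
  have := at0 (delta_mx 0 1); rewrite dotp_row3 /dot2 !mxE /=.
  rewrite !mulr1 !mulr0 !add0r => /eqP; rewrite addr_eq0 => /eqP ->.
  by rewrite /n; ring.
have E2 : a 0 ord_max = (slope_factor v)^-1.
  have : (slope_factor v * a 0 ord_max) ^+ 2 = 1.
    rewrite exprMn slope_factor_sqr [dot2 v v ^+ k.+1]exprSr.
    rewrite -radius_exp_sqr -[RHS]a1.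
    by rewrite -[a in dotp _ a]row3_eta dotp_row3 E0 E1 /dot2; ring.
  move/eqP; rewrite sqrf_eq1 => /orP[/eqP h|/eqP h].
    by rewrite -[LHS](mulKf Wn) h mulr1.
  by have := mulr_gt0 W0 a_gt0; rewrite h oppr_gt0 ltr10.
by rewrite -[LHS]row3_eta E0 E1 E2.
Qed.

End NormalOfPowerGraph.

(** * The curvature as a function of the angle *)

Section CurvatureProfile.
Context {R : realType}.

(** With s = r^2 and e = n - 1 = k + 1, one has 1 - y^2 = n^2 s^(k+1) y^2, so the last power splits
    into powers of n, s and y. The exponents add up to 2/e + 2k/e = 2 for n and 2n/e + 2k/e = 4 for
    y, and s gets k. *)
Lemma K_profile_slope_factor (k : nat) (v : 'rV[R]_2) :
  let n : R := k.+2%:R in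
  n `^ (2 / (n - 1)) * K_profile k.+2 (slope_factor k v)^-1 =
  n ^+ 2 * k.+1%:R * dot2 v v ^+ k / slope_factor k v ^+ 4.
Proof.
move=> n; have W0 := slope_factor_gt0 k v.
have Wn : slope_factor k v != 0 by rewrite gt_eqF.
pose e : R := k.+1%:R.
have e0 : e != 0 by rewrite pnatr_eq0.
have nE : n - 1 = e by rewrite /n -addn1 natrD addrK.
have kE : n - 2 = k%:R by rewrite /n -addn2 natrD addrK.
have s0 := dot2_ge0 v.
set y := (slope_factor k v)^-1.
have y0 : 0 < y by rewrite invr_gt0.
have yE : 1 - y ^+ 2 = n ^+ 2 * dot2 v v ^+ k.+1 * y ^+ 2.
  transitivity ((slope_factor k v ^+ 2 - 1) * y ^+ 2).
    by rewrite /y; field.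
  by rewrite slope_factor_sqr addrC addKr.
have pw (x : R) (m : nat) (b : R) : 0 <= x -> (x ^+ m) `^ b = x `^ (m%:R * b).
  by move=> x0; rewrite -powR_mulrn // powRrM.
rewrite /K_profile -/n nE kE yE.
have [n20 sk0 y20] : [/\ 0 <= n ^+ 2, 0 <= dot2 v v ^+ k.+1 & 0 <= y ^+ 2].
  by rewrite !sqr_ge0 exprn_ge0.
rewrite (powRM _ (mulr_ge0 n20 sk0) y20) (powRM _ n20 sk0) !pw ?(ltW y0) //.
(* Valid at s = 0 as well; for k = 0 both sides are then 1, the vertex of the paraboloid. *)
have sE : dot2 v v `^ (k.+1%:R * (k%:R / e)) = dot2 v v ^+ k.
  by rewrite -/e mulrCA divff // mulr1 powR_mulrn.
have nnE : n `^ (2 / e) * n `^ (2 * (k%:R / e)) = n ^+ 2.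
  rewrite -powRD; last by rewrite pnatr_eq0 implybT.
  rewrite -powR_mulrn //; congr (_ `^ _).
  by rewrite /e -[k.+1]addn1 natrD; field; rewrite -[1]/(1%:R) -natrD addn1.
have yyE : y `^ (2 * n / e) * y `^ (2 * (k%:R / e)) = y ^+ 4.
  rewrite -powRD; last by rewrite (gt_eqF y0) implybT.
  rewrite -powR_mulrn ?(ltW y0) //; congr (_ `^ _).
  have -> : n = k%:R + 2 by rewrite -kE subrK.
  have -> : e = k%:R + 1 by rewrite /e -addn1 natrD.
  by field; rewrite -[1]/(1%:R) -natrD addn1.
rewrite sE -nnE.
transitivity (n `^ (2 / e) * n `^ (2 * (k%:R / e)) * e * dot2 v v ^+ k *
   (y `^ (2 * n / e) * y `^ (2 * (k%:R / e)))); first by ring.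
by rewrite yyE /y exprVn.
Qed.

End CurvatureProfile.

(** * Gauss curvature in an arbitrary parametrization *)

Section ParametrizedPowerGraph.
Context {R : realType}.
Variables (k : nat) (U : set 'rV[R]_2) (X : 'rV[R]_2 -> 'rV[R]_3).
Variable q : 'rV[R]_2.
Hypotheses (PX : parametrization (range (power_graph k)) U X) (Uq : U q).

(** The openness clause, applied to U itself, shows that X maps U into the surface, where [hproj]
    inverts the graph map. *)
Lemma parametrization_on_power_graph y :
  U y -> X y = power_graph k (hproj (X y)).
Proof.
move=> Uy; have [oU _ _ _ /(_ U oU (fun _ => id)) [V _ E]] := PX.
have [] : (range (power_graph k) `&` V) (X y) by rewrite -E; exists y.
by move=> [v _ <-] _; rewrite hproj_power_graph.
Qed.

(** The differential at q of the change of coordinates h = [hproj \o X]. *)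
Let dh w := hproj ('d X q w).

Lemma is_diff_hproj_parametrization : is_diff q (hproj \o X) dh.
Proof.
have [_ [C1X _] _ _ _] := PX; have [dX _] := C1X q Uq.
exact: (is_diff_comp (differentiableP dX) (is_diff_hproj (X q))).
Qed.

(** Chain rule for X = G o h, an identity valid on the neighbourhood U of q. *)
Lemma diff_parametrization w :
  'd X q w = power_graph_diff k (hproj (X q)) (dh w).
Proof.
have [oU _ _ _ _] := PX.
have D : is_diff q (power_graph k \o (hproj \o X)) _ :=
  is_diff_comp is_diff_hproj_parametrization
    (is_diff_power_graph k (hproj (X q))).
have N : \forall y \near q, (power_graph k \o (hproj \o X)) y = X y.
  have : nbhs q U by exact: open_nbhs_nbhs.
  by apply: filterS => y Uy; rewrite /= -parametrization_on_power_graph.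
by have [_ ->] := is_diff_near_eq D N.
Qed.

Lemma gauss_curvature_power_graph (eta : 'rV[R]_3 -> 'rV[R]_3) :
  (forall v, eta (power_graph k v) = normal k v) ->
  gauss_curvature eta X q (\det (shape k (hproj (X q)))).
Proof.
move=> etaE; have [oU _ injX _ _] := PX; set B := shape k (hproj (X q)).
have D : is_diff q (normal k \o (hproj \o X)) _ :=
  is_diff_comp is_diff_hproj_parametrization (is_diff_normal k (hproj (X q))).
have N : \forall y \near q, (normal k \o (hproj \o X)) y = (eta \o X) y.
  have : nbhs q U by exact: open_nbhs_nbhs.
  apply: filterS => y Uy.
  by rewrite /= [X y in RHS]parametrization_on_power_graph // etaE.
have [deta detaE] := is_diff_near_eq D N; split=> //.
have [_ dhE] := is_diff_hproj_parametrization.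
pose H := lin1_mx ('d (hproj \o X) q).
have HE w : w *m H = dh w by rewrite mul_rV_lin1 dhE.
have dXE w : 'd X q w = power_graph_diff k (hproj (X q)) (w *m H).
  by rewrite diff_parametrization HE.
(* A vector killed by H is killed by dX, which is injective. *)
have Hu : H \in unitmx.
  rewrite unitmxE unitfE; apply/det0P => -[w w0 wH].
  case/eqP: w0; apply: (injX q Uq).
  by rewrite !dXE wH mul0mx.
have HA w : w *m (H *m B *m invmx H) *m H = dh w *m B.
  by rewrite mulmxA (mulmxKV Hu) mulmxA HE.
(* With row vectors, w A must satisfy w A H = w H B, hence the order of the conjugation. *)
exists (H *m B *m invmx H).
  (* Rewriting with [detaE] makes unification unfold the differentials. *)
  move=> w; apply: (etrans (congr1 (fun f => f w) detaE)).
  by apply: (etrans _ (esym (dXE _))); rewrite HA.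
have dH : \det H != 0 by rewrite -unitfE -unitmxE.
by rewrite !det_mulmx det_inv mulrAC (divff dH) mul1r.
Qed.

End ParametrizedPowerGraph.

(** * Existence and uniqueness of the upward Gauss map, and the curvature equation *)

Lemma normal_gauss_map {R : realType} (k : nat) :
  upward_gauss_map (range (@power_graph R k)) (normal k \o hproj).
Proof.
split; [split|].
(* Extended constantly along vertical lines, the normal is differentiable on all of R^3. *)
- apply: continuous_subspaceT => p; apply: is_diff_continuous.
  exact: (is_diff_comp (is_diff_hproj p) (is_diff_normal k (hproj p))).
- by move=> p _; exact: dotp_normal.
- move=> U X q w PX Uq; rewrite (diff_parametrization _ _ _ _ PX Uq).
  exact: dotp_normal_tangent.
- by move=> p _; rewrite angleE row3_2 invr_gt0 slope_factor_gt0.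
Qed.

(** The tangency clause, tested on the graph parametrization alone, already determines the normal at
    every point. *)
Lemma upward_gauss_map_unique {R : realType} (k : nat)
    (eta : 'rV[R]_3 -> 'rV[R]_3) :
  upward_gauss_map (range (power_graph k)) eta ->
  forall v, eta (power_graph k v) = normal k v.
Proof.
move=> [[_ eta1 etat] eta_gt0] v.
have Gv : range (power_graph k) (power_graph k v) by exists v.
apply: normal_unique; [exact: eta1| |by rewrite -angleE; exact: eta_gt0].
move=> w; have := etat _ _ v w (parametrization_power_graph k) I.
by have [_ ->] := is_diff_power_graph k v.
Qed.

Theorem proposition4p1 (R : realType) (n : nat) (hn : (2 <= n)%N) :
  let S : set 'rV[R]_3 := revolution (fun x : R => x ^+ n) in
  (exists eta, upward_gauss_map S eta) /\
  (forall eta, upward_gauss_map S eta -> 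
     K_surface (fun y : R => n%:R `^ (2 / (n%:R - 1)) * K_profile n y) S eta).
Proof.
case: n hn => [|[|k]] // _ S; rewrite /S revolution_power; split.
  by exists (normal k \o hproj); exact: normal_gauss_map.
move=> eta eta_up; have etaE := upward_gauss_map_unique _ _ eta_up.
split=> [p [v _ <-]||U X q PX Uq]; last 1 first.
(* The angle at X q is the third coordinate 1 / W of the normal, so the prescribed value is the
   determinant of [shape]. *)
- rewrite angleE (parametrization_on_power_graph _ _ _ PX _ Uq) etaE row3_2.
  rewrite K_profile_slope_factor -det_shape.
  exact: (gauss_curvature_power_graph _ _ _ _ PX Uq _ etaE).
- exists setT, (power_graph k), v.
  by split; [exact: parametrization_power_graph|exact: I|].
- by case: eta_up.
Qed.
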